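(* Let $n$ be a positive integer. If $n\in\{15,16,19,20,21,22\}$ or $n\geq 24$, then there is a partition $\lambda$ of $n$ with $\lambda\neq\lambda'$ such that the generic degrees of $\lambda$ and of the conjugate partition $\lambda'$ are the same (equivalently, $a(\lambda)=a(\lambda')$). For every other positive integer $n$ there is no such partition.
   Context: A partition $\lambda=(\lambda_1,\dots,\lambda_r)$ of $n$ is a sequence of positive integers with $\lambda_1\geq\dots\geq\lambda_r$ and sum $n$. Its Young diagram has $\lambda_i$ left-aligned boxes in row $i$. The conjugate partition $\lambda'$ is obtained by reflecting the Young diagram in the main diagonal. The hook of a box consists of the box itself, all boxes below it in the same column, and all boxes to the right of it in the same row; its length is the number of boxes in it. $H(\lambda)$ denotes the multiset of hook lengths of the boxes of $\lambda$ (one always has $H(\lambda)=H(\lambda')$). Lusztig's $a$-function is $a(\lambda)=\sum_{i=1}^r (i-1)\lambda_i$. The unipotent characters $\chi_\lambda$ of $\mathrm{GL}_n(q)$ are labelled by the partitions $\lambda$ of $n$, and the generic degree of $\lambda$ (or of $\chi_\lambda$) is the polynomial in $q$ given by $$q^{a(\lambda)}\frac{\prod_{i=1}^n (q^i-1)}{\prod_{h\in H(\lambda)} (q^h-1)}.$$ Generic degrees are compared as polynomials in the indeterminate $q$. *)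

(* Defs.v *)
From mathcomp Require Import all_boot all_order all_algebra.

Set Implicit Arguments.
Unset Strict Implicit.
Unset Printing Implicit Defensive.

Import GRing.Theory.
Local Open Scope nat_scope.

Definition is_partition (n : nat) (la : seq nat) : bool :=
  [&& sorted geq la, all (fun x => 0 < x) la & sumn la == n].

(* Rows and columns are numbered from 0; a box is a pair (row, column). *)
Definition boxes (la : seq nat) : seq (nat * nat) :=
  [seq (i, j) | i <- iota 0 (size la), j <- iota 0 (nth 0 la i)].

(* Row j of the reflected diagram is column j of the diagram of la, and that
   diagram has head 0 la columns. *)
Definition conj_partition (la : seq nat) : seq nat :=
  [seq count (fun b => b.2 == j) (boxes la) | j <- iota 0 (head 0 la)].

Definition in_hook (b c : nat * nat) : bool :=
  ((c.2 == b.2) && (b.1 <= c.1)) || ((c.1 == b.1) && (b.2 <= c.2)).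

Definition hook_length (la : seq nat) (b : nat * nat) : nat :=
  count (in_hook b) (boxes la).

(* As a multiset: the order of the entries is irrelevant, repetitions are kept. *)
Definition hook_lengths (la : seq nat) : seq nat :=
  [seq hook_length la b | b <- boxes la].

(* The factor i - 1 of the usual formula becomes i, rows starting at 0. *)
Definition lusztig_a (la : seq nat) : nat :=
  \sum_(0 <= i < size la) i * nth 0 la i.

(* The quotient is formed in the field Q(q), where division is exact; since
   Q[q] embeds in Q(q), equality here is equality of polynomials. *)
Definition generic_degree (la : seq nat) : {fraction {poly rat}} :=
  (tofrac ('X^(lusztig_a la) * \prod_(1 <= i < (sumn la).+1) ('X^i - 1))
   / tofrac (\prod_(h <- hook_lengths la) ('X^h - 1)))%R.

(* Main.v *)
Require Import Defs.
From mathcomp Require Import all_boot all_order all_algebra zify.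

Set Implicit Arguments.
Unset Strict Implicit.
Unset Printing Implicit Defensive.

Import GRing.Theory.
Local Open Scope nat_scope.

(** Transposing the diagram of [la] is a bijection onto the diagram of the
    conjugate partition that preserves hook lengths
    ([perm_hook_lengths_conj]).  The generic degrees of [la] and of its
    conjugate therefore differ only in the power of q in front, and they agree
    exactly when [lusztig_a] does ([generic_degree_conj]).  Summing the row
    index over the boxes of both diagrams, this becomes an elementary identity
    between the parts of [la], with column indices replacing row indices for
    the conjugate: [tail_sums la = row_binomials la], the predicate [balanced].
    Equivalently, the contents (column minus row) of the boxes of [la] sum
    to 0.

    For existence in large degree, put around the diagram of [la] a new first
    row and a new first column, both with k.+1 boxes, where k is at least the
    number of rows and of columns of [la].  A box of [la] moves one step along
    the diagonal and so keeps its content, while the contents of the symmetric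
    hook cancel: [balanced] is preserved ([balanced_add_hook]).  A box whose
    transpose is missing still has that property after the shift, so the new
    partition is not self-conjugate either.  Its size is that of [la] plus
    k.*2.+1.  Starting from one example of size 15 and one of size 16, both
    inside the 6 by 6 square, every k >= 6 is possible, and this covers every
    even n >= 28 and every odd n >= 29.  The remaining values of n in the
    positive part are settled by explicit partitions.

    The negative part concerns only 1, ..., 14, 17, 18 and 23, and there all
    partitions are enumerated ([no_coincidence_small]). *)

(** * Boxes of a diagram and of its transpose *)

Lemma mem_boxes (la : seq nat) (i j : nat) :
  ((i, j) \in boxes la) = (j < nth 0 la i).
Proof.
apply/allpairsPdep/idP => [[i' [j' [_]]]|lt_j].
  by rewrite mem_iota => /= lt_j [-> ->].
exists i, j; rewrite !mem_iota; split=> //=.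
by rewrite ltnNge; apply: contraL lt_j => /(nth_default 0) ->.
Qed.

Lemma boxes_uniq (la : seq nat) : uniq (boxes la).
Proof.
apply: allpairs_uniq_dep => [|i _|]; rewrite ?iota_uniq //.
by move=> [i j] [i' j'] _ _ /= [-> ->].
Qed.

Lemma size_boxes (la : seq nat) : size (boxes la) = sumn la.
Proof.
rewrite size_allpairs_dep -[in RHS](mkseq_nth 0 la) /mkseq.
by congr sumn; apply: eq_map => i; rewrite size_iota.
Qed.

Lemma count_column (la : seq nat) (j : nat) :
  count (fun b => b.2 == j) (boxes la) = count (ltn j) la.
Proof.
rewrite count_flatten -map_comp -[in RHS](mkseq_nth 0 la) /mkseq count_map.
rewrite -sumn_count; congr sumn; apply: eq_map => i /=.
by rewrite count_map (count_uniq_mem j (iota_uniq _ _)) mem_iota.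
Qed.

Lemma leq_nth_head (la : seq nat) (i : nat) :
  sorted geq la -> nth 0 la i <= head 0 la.
Proof.
case: la i => [|x s] [|i] //= /(order_path_min (rev_trans leq_trans)).
move=> /(all_nthP 0) le_s.
by case: (ltnP i (size s)) => [/le_s //|/(nth_default 0) ->].
Qed.

(** The parts exceeding [j] form an initial segment of a decreasing sequence,
    so their number is larger than [i] exactly when part [i] is among them. *)
Lemma ltn_count_column (la : seq nat) (i j : nat) :
  sorted geq la -> (i < count (ltn j) la) = (j < nth 0 la i).
Proof.
elim: la i => [|x s IHs] i sorted_la; first by rewrite nth_nil !ltn0.
have sorted_s : sorted geq s by apply: path_sorted sorted_la.
case: (ltnP j x) => [lt_jx|le_xj].
  by rewrite /= lt_jx; case: i => [|i] //=; rewrite add1n ltnS IHs.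
have -> : count (ltn j) (x :: s) = 0.
  apply/eqP; rewrite -leqn0 leqNgt -has_count.
  apply/hasPn => _ /(nthP 0)[l _ <-].
  by rewrite /= -leqNgt (leq_trans (leq_nth_head l sorted_la)).
by rewrite [RHS]ltnNge (leq_trans (leq_nth_head i sorted_la)).
Qed.

(** The transposition symmetry of the two diagrams in terms of parts.  The
    default value 0 of [nth] stands for the empty rows below a diagram, so the
    equivalence holds for all [i] and [j]. *)
Lemma nth_conj_partition (la : seq nat) (i j : nat) : sorted geq la ->
  (i < nth 0 (conj_partition la) j) = (j < nth 0 la i).
Proof.
move=> sorted_la; case: (ltnP j (head 0 la)) => [lt_j|le_j].
  rewrite (nth_map 0) ?size_iota // nth_iota // count_column.
  exact: ltn_count_column.
rewrite nth_default ?size_map ?size_iota // ltn0.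
by apply/esym/negbTE; rewrite -leqNgt (leq_trans (leq_nth_head _ _)).
Qed.

Definition transpose (b : nat * nat) : nat * nat := (b.2, b.1).

Lemma perm_boxes_conj (la : seq nat) : sorted geq la ->
  perm_eq (boxes (conj_partition la)) (map transpose (boxes la)).
Proof.
move=> sorted_la.
have transposeK : involutive transpose by case.
apply: uniq_perm; rewrite ?(map_inj_uniq (inv_inj transposeK)) ?boxes_uniq //.
move=> [j i]; rewrite -{2}[(j, i)]transposeK (mem_map (inv_inj transposeK)).
by rewrite !mem_boxes nth_conj_partition.
Qed.

(** * Hooks and generic degrees *)

Lemma sumn_conj (la : seq nat) :
  sorted geq la -> sumn (conj_partition la) = sumn la.
Proof.
move=> sorted_la; rewrite -!size_boxes (perm_size (perm_boxes_conj sorted_la)).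
exact: size_map.
Qed.

(** Transposition exchanges the two arms of every hook. *)
Lemma hook_length_conj (la : seq nat) (b : nat * nat) : sorted geq la ->
  hook_length (conj_partition la) (transpose b) = hook_length la b.
Proof.
move=> sorted_la; rewrite /hook_length (permP (perm_boxes_conj sorted_la)).
by rewrite count_map; apply: eq_count => c; rewrite /in_hook /= orbC.
Qed.

Lemma perm_hook_lengths_conj (la : seq nat) : sorted geq la ->
  perm_eq (hook_lengths (conj_partition la)) (hook_lengths la).
Proof.
move=> sorted_la; rewrite /hook_lengths.
rewrite (perm_trans (perm_map _ (perm_boxes_conj sorted_la))) // -map_comp.
have eq_hook := fun b => hook_length_conj b sorted_la.
by rewrite (eq_map eq_hook).
Qed.

Lemma hook_length_gt0 (la : seq nat) (b : nat * nat) :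
  b \in boxes la -> 0 < hook_length la b.
Proof.
move=> b_la; rewrite -has_count; apply/hasP; exists b => //.
by rewrite /in_hook !eqxx leqnn.
Qed.

(** * The a-function of a partition and of its conjugate *)

Lemma lusztig_a_boxes (la : seq nat) : lusztig_a la = \sum_(b <- boxes la) b.1.
Proof.
rewrite /boxes big_allpairs_dep /lusztig_a /index_iota subn0.
apply: eq_bigr => i _.
by rewrite big_const_seq count_predT size_iota iter_addn_0.
Qed.

(** Row [i] is counted once in each of the [i] tails that contain it and
    start below the first row, so this is [lusztig_a] in a form that can be
    evaluated. *)
Fixpoint tail_sums (la : seq nat) : nat :=
  if la is _ :: s then sumn s + tail_sums s else 0.

Lemma lusztig_a_tail_sums (la : seq nat) : lusztig_a la = tail_sums la.
Proof.
rewrite /lusztig_a; elim: la => [|x s IHs]; first by rewrite big_geq.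
have sumn_s : sumn s = \sum_(0 <= i < size s) nth 0 s i.
  by rewrite sumnE (big_nth 0).
rewrite big_nat_recl //= mul0n add0n -IHs sumn_s -big_split /=.
by apply: eq_bigr => i _; rewrite mulSn.
Qed.

Definition row_binomials (la : seq nat) : nat := sumn [seq 'C(x, 2) | x <- la].

(** Row indices in the conjugate diagram are column indices in [la], and the
    column indices 0, ..., x - 1 of a row of length x add up to 'C(x, 2). *)
Lemma lusztig_a_conj (la : seq nat) : sorted geq la ->
  lusztig_a (conj_partition la) = row_binomials la.
Proof.
move=> sorted_la.
rewrite lusztig_a_boxes (perm_big _ (perm_boxes_conj sorted_la)) big_map /=.
rewrite /row_binomials sumnE big_map (big_nth 0) big_allpairs_dep.
rewrite /index_iota subn0; apply: eq_bigr => i _ /=.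
by rewrite -bin2_sum /index_iota subn0.
Qed.

Definition balanced (la : seq nat) : bool := tail_sums la == row_binomials la.

Lemma balancedP (la : seq nat) : sorted geq la ->
  reflect (lusztig_a la = lusztig_a (conj_partition la)) (balanced la).
Proof.
move=> sorted_la; rewrite lusztig_a_conj // lusztig_a_tail_sums; exact: eqP.
Qed.

(** After cancellation of the common nonzero factors only the power of 'X is
    left, and its exponent is read off from its degree. *)
Lemma generic_degree_conj (la : seq nat) : sorted geq la ->
  generic_degree la = generic_degree (conj_partition la) <->
  lusztig_a la = lusztig_a (conj_partition la).
Proof.
move=> sorted_la; split=> [|eq_a]; last first.
  rewrite /generic_degree -eq_a sumn_conj //.
  by rewrite (perm_big _ (perm_hook_lengths_conj sorted_la)).
rewrite /generic_degree sumn_conj //.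
rewrite (perm_big _ (perm_hook_lengths_conj sorted_la)).
have nz_hooks : (\prod_(h <- hook_lengths la) ('X^h - 1) != 0 :> {poly rat})%R.
  rewrite big_map big_seq prodf_seq_neq0; apply/allP => b b_la.
  by rewrite b_la -polyC1 monic_neq0 // monicXnsubC // hook_length_gt0.
have nz_num : (\prod_(1 <= i < (sumn la).+1) ('X^i - 1) != 0 :> {poly rat})%R.
  rewrite big_nat prodf_seq_neq0.
  apply/allP => i _; apply/implyP => /andP[i_gt0 _].
  by rewrite -polyC1 monic_neq0 // monicXnsubC.
rewrite -tofrac_eq0 in nz_hooks.
move/(divIf nz_hooks)/eqP; rewrite tofrac_eq => /eqP/(mulIf nz_num).
by move/(congr1 (fun p : {poly rat} => size p)); rewrite !size_polyXn => -[].
Qed.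

(** * Adding a symmetric hook *)

Definition add_column (k : nat) (la : seq nat) : seq nat :=
  [seq x.+1 | x <- la] ++ nseq (k - size la) 1.

(** The new corner box is part of the new row, so that the row and the column
    have k.+1 boxes each when [size la <= k]. *)
Definition add_hook (k : nat) (la : seq nat) : seq nat :=
  k.+1 :: add_column k la.

Lemma nth_add_column (k : nat) (la : seq nat) (i : nat) : size la <= k ->
  nth 0 (add_column k la) i = if i < k then (nth 0 la i).+1 else 0.
Proof.
move=> le_k; rewrite nth_cat size_map.
case: (ltnP i (size la)) => [lt_i|le_i].
  by rewrite (nth_map 0) // (leq_trans lt_i le_k).
by rewrite nth_nseq ltn_sub2rE // [nth 0 la i]nth_default.
Qed.

Lemma sumn_add_column (k : nat) (la : seq nat) :
  size la <= k -> sumn (add_column k la) = sumn la + k.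
Proof.
move=> le_k; rewrite sumn_cat sumn_nseq mul1n.
have -> : sumn [seq x.+1 | x <- la] = sumn la + size la.
  by elim: la {le_k} => //= x s ->; rewrite addSn addnS addnA.
by rewrite -addnA subnKC.
Qed.

Lemma tail_sums_add_column (k : nat) (la : seq nat) :
  size la <= k -> tail_sums (add_column k la) = tail_sums la + 'C(k, 2).
Proof.
elim: la k => [|x s IHs] k.
  move=> _; rewrite /add_column subn0 /=; elim: k => //= k ->.
  by rewrite sumn_nseq mul1n binS bin1 addnC.
case: k => // k le_k; rewrite /add_column /= subSS -/(add_column k s).
by rewrite IHs // sumn_add_column // binS bin1 addnACA [k + _]addnC.
Qed.

Lemma row_binomials_add_column (k : nat) (la : seq nat) :
  row_binomials (add_column k la) = row_binomials la + sumn la.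
Proof.
rewrite /row_binomials map_cat sumn_cat map_nseq sumn_nseq addn0.
by elim: la => //= x s ->; rewrite binS bin1 addnACA.
Qed.

(** Both sides of the balance grow by the same amount
    [sumn la + k + 'C(k, 2)]: each old box moves one row down and one column to
    the right, and the new column contributes as much to the row indices as the
    new row to the column indices. *)
Lemma balanced_add_hook (k : nat) (la : seq nat) :
  size la <= k -> balanced (add_hook k la) = balanced la.
Proof.
move=> le_k; rewrite /balanced /add_hook /= sumn_add_column //.
rewrite tail_sums_add_column // /row_binomials /= -/(row_binomials _).
rewrite row_binomials_add_column binS bin1.
have -> : sumn la + k + (tail_sums la + 'C(k, 2)) =
          tail_sums la + (sumn la + k + 'C(k, 2)) by rewrite addnCA addnA.
have -> : 'C(k, 2) + k + (row_binomials la + sumn la) =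
          row_binomials la + (sumn la + k + 'C(k, 2)).
  by rewrite addnCA [_ + sumn la]addnC [in LHS]addnA -!addnA [k + _]addnC addnA.
by rewrite eqn_add2r.
Qed.

Lemma partition_add_hook (k n : nat) (la : seq nat) :
  size la <= k -> head 0 la <= k -> is_partition n la ->
  is_partition (n + k.*2.+1) (add_hook k la).
Proof.
move=> le_size le_head /and3P[sorted_la pos_la /eqP sum_la].
have le_nthS i : nth 0 la i.+1 <= nth 0 la i.
  case: (ltnP i.+1 (size la)) => [|/(nth_default 0) -> //].
  by move/sortedP: sorted_la; apply.
apply/and3P; split.
- apply/(sortedP 0) => -[|i] /=.
    by rewrite nth_add_column // nth0; case: ifP.
  rewrite !nth_add_column // ltnS => _.
  by case: ltnP => // lt_i; rewrite (ltnW lt_i) ltnS le_nthS.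
- rewrite /= all_cat all_nseq orbT andbT all_map.
  by apply/allP.
- by rewrite /= sumn_add_column // sum_la -addnn addSn addnS addnCA.
Qed.

(** The box [(i, j)] lies in the diagram and its transpose does not.  Unlike
    [la <> conj_partition la], this visibly survives a diagonal shift. *)
Definition asymmetric (la : seq nat) : Prop :=
  exists i j : nat, j < nth 0 la i /\ nth 0 la j <= i.

Lemma asymmetric_neq_conj (la : seq nat) :
  sorted geq la -> asymmetric la -> la <> conj_partition la.
Proof.
move=> sorted_la [i [j [lt_j le_i]]] eq_la; move: lt_j.
by rewrite -nth_conj_partition // -eq_la ltnNge le_i.
Qed.

Lemma asymmetric_add_hook (k : nat) (la : seq nat) :
  size la <= k -> asymmetric la -> asymmetric (add_hook k la).
Proof.
move=> le_k [i [j [lt_j le_i]]]; exists i.+1, j.+1.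
rewrite /= !nth_add_column //.
have lt_i : i < k.
  rewrite (leq_trans _ le_k) // ltnNge.
  by apply: contraL lt_j => /(nth_default 0) ->.
by rewrite lt_i; case: ifP.
Qed.

(** * Existence *)

Definition has_coincidence (n : nat) : Prop :=
  exists la : seq nat,
    [/\ is_partition n la, la <> conj_partition la & balanced la].

Lemma has_coincidence_add_hook (n k : nat) (la : seq nat) :
  is_partition n la -> balanced la -> asymmetric la ->
  size la <= k -> head 0 la <= k -> has_coincidence (n + k.*2.+1).
Proof.
move=> part_la bal_la asym_la le_size le_head; exists (add_hook k la).
have part_hook := partition_add_hook le_size le_head part_la.
split; rewrite ?balanced_add_hook //.
apply: asymmetric_neq_conj; last exact: asymmetric_add_hook.
by case/and3P: part_hook.
Qed.

(** A hook with parameter k adds the odd number k.*2.+1 of boxes, so each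
    parity of [n] needs a starting partition of the other parity.  Both have
    at most 6 rows and columns, and k >= 6 amounts to n >= 28 or n >= 29. *)
Lemma has_coincidence_large (n : nat) : 28 <= n -> has_coincidence n.
Proof.
move=> le_n; have [odd_n|even_n] := boolP (odd n).
  have -> : n = 16 + ((n - 17)./2).*2.+1.
    lia.
  apply: (@has_coincidence_add_hook 16 _ [:: 6; 3; 3; 2; 2]) => //=.
  - by exists 4, 1.
  - lia.
  - lia.
have -> : n = 15 + ((n - 16)./2).*2.+1.
  lia.
apply: (@has_coincidence_add_hook 15 _ [:: 6; 3; 2; 2; 2]) => //=.
- by exists 3, 1.
- lia.
- lia.
Qed.

Lemma has_coincidence_explicit (n : nat) (la : seq nat) :
  [&& is_partition n la, la != conj_partition la & balanced la] ->
  has_coincidence n.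
Proof. by case/and3P=> ? /eqP ? ?; exists la. Qed.

Definition small_coincidences : seq (nat * seq nat) :=
  [:: (15, [:: 6; 3; 2; 2; 2]); (16, [:: 6; 3; 3; 2; 2]);
      (19, [:: 7; 3; 3; 3; 2; 1]); (20, [:: 6; 4; 4; 3; 3]);
      (21, [:: 6; 4; 4; 4; 3]); (22, [:: 8; 4; 3; 2; 2; 2; 1]);
      (24, [:: 7; 5; 4; 3; 3; 2]); (25, [:: 7; 6; 3; 3; 3; 3]);
      (26, [:: 9; 4; 3; 3; 3; 2; 2]); (27, [:: 8; 5; 5; 3; 2; 2; 2])].

Lemma small_coincidencesP :
  all (fun c => [&& is_partition c.1 c.2, c.2 != conj_partition c.2
                  & balanced c.2]) small_coincidences.
Proof. by vm_compute. Qed.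

(** * Enumeration of small partitions *)

(** The largest part [k] is removed and bounds the parts that remain.  As [k]
    is positive, [n] steps reach the empty partition, so a [fuel] of at least
    [n] loses no partition. *)
Fixpoint partitions_bounded (fuel m n : nat) : seq (seq nat) :=
  if n is 0 then [:: [::]] else
  if fuel is fuel'.+1 then
    [seq k :: s | k <- iota 1 (minn m n),
                  s <- partitions_bounded fuel' k (n - k)]
  else [::].

Lemma mem_partitions_bounded (fuel m n : nat) (la : seq nat) :
  n <= fuel -> head 0 la <= m -> is_partition n la ->
  la \in partitions_bounded fuel m n.
Proof.
elim: fuel m n la => [|fuel IHf] m n [|x s] le_n le_m.
- by case/and3P=> _ _ /eqP <-.
- move: le_n; rewrite leqn0 => /eqP -> /and3P[_ /= /andP[x_gt0 _]].
  by rewrite addn_eq0 eqn0Ngt x_gt0.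
- by case/and3P=> _ _ /eqP <-.
case/and3P=> sorted_la /= /andP[x_gt0 pos_s] /eqP sum_la.
have n_gt0 : 0 < n by rewrite -sum_la ltn_addr.
have le_xn : x <= n by rewrite -sum_la leq_addr.
rewrite -(prednK n_gt0) /= (prednK n_gt0).
apply: allpairs_f_dep.
  by rewrite mem_iota x_gt0 add1n ltnS leq_min le_m.
apply: IHf.
- by rewrite leq_subLR (leq_trans le_n) // -add1n leq_add2r.
- by have := leq_nth_head 1 sorted_la; rewrite /= nth0.
- apply/and3P; split=> //; first exact: path_sorted sorted_la.
  by rewrite -sum_la addKn.
Qed.

Definition only_symmetric_balanced (n : nat) : bool :=
  all (fun la => balanced la ==> (la == conj_partition la))
      (partitions_bounded n n n).

Lemma no_coincidence (n : nat) :
  only_symmetric_balanced n -> ~ has_coincidence n.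
Proof.
move=> /allP all_n [la [part_la neq_la bal_la]]; apply: neq_la; apply/eqP.
apply: implyP bal_la; apply: all_n; apply: mem_partitions_bounded => //.
case/and3P: part_la => _ _ /eqP <-.
by case: la => //= x s; rewrite leq_addr.
Qed.

Lemma no_coincidence_small :
  all only_symmetric_balanced [:: 17, 18, 23 & iota 1 14].
Proof. by vm_compute. Qed.

(** * The classification *)

Lemma has_coincidenceP (n : nat) : has_coincidence n <->
  exists la : seq nat,
    [/\ is_partition n la, la <> conj_partition la
      & generic_degree la = generic_degree (conj_partition la)].
Proof.
split=> -[la [part_la neq_la]]; have /and3P[sorted_la _ _] := part_la.
  by move/(balancedP sorted_la)/(generic_degree_conj sorted_la); exists la.
by move/(generic_degree_conj sorted_la)/(balancedP sorted_la); exists la.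
Qed.

Theorem proposition3p7 (n : nat) (hn : 0 < n) :
  [/\ (n \in [:: 15; 16; 19; 20; 21; 22]) || (24 <= n) ->
      exists la : seq nat,
        [/\ is_partition n la, la <> conj_partition la
          & generic_degree la = generic_degree (conj_partition la)],
      ~~ ((n \in [:: 15; 16; 19; 20; 21; 22]) || (24 <= n)) ->
      ~ exists la : seq nat,
        [/\ is_partition n la, la <> conj_partition la
          & generic_degree la = generic_degree (conj_partition la)]
    & forall la : seq nat, is_partition n la ->
      (generic_degree la = generic_degree (conj_partition la) <->
       lusztig_a la = lusztig_a (conj_partition la))].
Proof.
split=> [n_in|n_notin|la /and3P[sorted_la _ _]]; last exact: generic_degree_conj.
- apply/has_coincidenceP.
  have [/has_coincidence_large //|lt_n] := leqP 28 n.
  have /mapP[[m la] la_in ->] : n \in unzip1 small_coincidences.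
    by move: n_in; rewrite /= !inE; lia.
  apply: (@has_coincidence_explicit m la).
  exact: (allP small_coincidencesP _ la_in).
- move/has_coincidenceP; apply: no_coincidence.
  apply: (allP no_coincidence_small).
  by move: n_notin; rewrite !inE; lia.
Qed.
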